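(* Consider the quadratic program with feasible set $$\Omega=\{x\in\mathbb{R}^n: c_i^{\top}x=b_i\ (1\le i\le m_{\mathrm{eq}}),\ c_i^{\top}x\ge b_i\ (m_{\mathrm{eq}}<i\le m)\}$$ and the state $(\mathcal A,x,u,u_*,J,R)$ of the Goldfarb–Idnani dual active-set iteration described in the context, with an entering inequality constraint $i_*>m_{\mathrm{eq}}$ that is violated, i.e. $s_{i_*}=c_{i_*}^{\top}x-b_{i_*}<0$. With $n_*=c_{i_*}$ and $z,r$ as in the context, suppose (a) $z=0$, and (b) $r_i\le0$ for every inequality $i\in\mathcal A$ (i.e. every $i\in\mathcal A$ with $i>m_{\mathrm{eq}}$). Then $\Omega$ is empty.
   Context: The program is $\min_x \tfrac12x^{\top}Gx-a^{\top}x$ over $\Omega$, with $G\in\mathbb{R}^{n\times n}$ symmetric positive definite, $a\in\mathbb{R}^n$, $c_i\in\mathbb{R}^n$, $b_i\in\mathbb{R}$. A state consists of: a working set $\mathcal A\subseteq\{1,\dots,m\}$ of size $k$ whose normals form the matrix $A\in\mathbb{R}^{n\times k}$ (columns $c_i$, $i\in\mathcal A$) of full column rank, with right-hand sides $b_{\mathcal A}$; matrices $J\in\mathbb{R}^{n\times n}$ and $R\in\mathbb{R}^{k\times k}$ (upper triangular, nonsingular) with $J^{\top}GJ=I_n$ and $J^{\top}A=\begin{bmatrix}R\\0\end{bmatrix}$; an iterate $x$ with $A^{\top}x=b_{\mathcal A}$; and multipliers $u\in\mathbb{R}^k$, $u_*\ge0$ with $Gx-a=Au+u_*n_*$ and $u_i\ge0$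 for every inequality $i\in\mathcal A$. Partition $J=[\,J_1\ \ J_2\,]$ with $J_1\in\mathbb{R}^{n\times k}$; set $d=J^{\top}n_*=(d_1,d_2)$ with $d_1\in\mathbb{R}^k$, $z=J_2d_2$, $r=R^{-1}d_1$. The entries of $r$ and $u$ are indexed by the elements of $\mathcal A$. *)

(* Defs.v *)
From mathcomp Require Import all_boot all_order all_algebra.

Set Implicit Arguments.
Unset Strict Implicit.
Unset Printing Implicit Defensive.

Import Order.TTheory GRing.Theory Num.Theory.
Local Open Scope ring_scope.

Definition dotv (F : realFieldType) (n : nat) (v w : 'cV[F]_n) : F :=
  (v^T *m w) 0 0.

Definition posdefmx (F : realFieldType) (n : nat) (G : 'M[F]_n) : Prop :=
  forall v : 'cV[F]_n, v != 0 -> 0 < dotv v (G *m v).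

(* Data of  min 1/2 x^T G x - a^T x  subject to  c_i^T x = b_i  for the first  *)
(* qp_meq constraints and  c_i^T x >= b_i  for the others.  Constraints are    *)
(* numbered from 0, so that i is an equality iff i < qp_meq.                   *)
Record qp (F : realFieldType) (n m : nat) := QP {
  qp_G : 'M[F]_n;
  qp_a : 'cV[F]_n;
  qp_c : 'I_m -> 'cV[F]_n;
  qp_b : 'I_m -> F;
  qp_meq : nat;
  qp_meq_le : (qp_meq <= m)%N;
  qp_G_sym : qp_G^T = qp_G;
  qp_G_posdef : posdefmx qp_G
}.

Definition is_ineq (F : realFieldType) (n m : nat) (P : qp F n m) (i : 'I_m)
    : bool :=
  (qp_meq P <= i)%N.

Definition feasible (F : realFieldType) (n m : nat) (P : qp F n m)
    (y : 'cV[F]_n) : Prop :=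
  forall i : 'I_m,
    (~~ is_ineq P i -> dotv (qp_c P i) y = qp_b P i) /\
    (is_ineq P i -> qp_b P i <= dotv (qp_c P i) y).

Definition slack (F : realFieldType) (n m : nat) (P : qp F n m)
    (y : 'cV[F]_n) (i : 'I_m) : F :=
  dotv (qp_c P i) y - qp_b P i.

(* A working set is a duplicate-free tuple: the triangular factor depends on   *)
(* the order of the columns, so an (arbitrary) enumeration is recorded.        *)
(* Entry j of u and of r is the one indexed by the constraint tnth W j.        *)
Definition normals (F : realFieldType) (n m k : nat) (P : qp F n m)
    (W : k.-tuple 'I_m) : 'M[F]_(n, k) :=
  \matrix_(i < n, j < k) qp_c P (tnth W j) i 0.

Definition rhs (F : realFieldType) (n m k : nat) (P : qp F n m)
    (W : k.-tuple 'I_m) : 'cV[F]_k :=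
  \col_(j < k) qp_b P (tnth W j).

Lemma full_col_rank_leq (F : realFieldType) (n k : nat) (A : 'M[F]_(n, k)) :
  \rank A = k -> (k <= n)%N.
Proof. by move=> <-; exact: rank_leq_row. Qed.

(* Full column rank gives k <= n, hence the splitting n = k + (n - k) along    *)
(* which J and J^T A are partitioned.                                          *)
Record gi_state (F : realFieldType) (n m : nat) (P : qp F n m)
    (istar : 'I_m) (k : nat) := GIState {
  gi_W : k.-tuple 'I_m;
  gi_W_uniq : uniq gi_W;
  gi_rank : \rank (normals P gi_W) = k;
  gi_J : 'M[F]_n;
  gi_R : 'M[F]_k;
  gi_x : 'cV[F]_n;
  gi_u : 'cV[F]_k;
  gi_ustar : F;
  (* is_trig_mx means lower triangular *)
  gi_R_upper : is_trig_mx gi_R^T;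
  gi_R_unit : gi_R \in unitmx;
  gi_JGJ : gi_J^T *m qp_G P *m gi_J = 1%:M;
  gi_JA : gi_J^T *m normals P gi_W =
    castmx (subnKC (full_col_rank_leq gi_rank), erefl k)
      (col_mx gi_R (0 : 'M[F]_(n - k, k)));
  gi_x_active : (normals P gi_W)^T *m gi_x = rhs P gi_W;
  gi_stationary :
    qp_G P *m gi_x - qp_a P
      = normals P gi_W *m gi_u + gi_ustar *: qp_c P istar;
  gi_ustar_ge0 : 0 <= gi_ustar;
  gi_u_ge0 : forall j : 'I_k, is_ineq P (tnth gi_W j) -> 0 <= gi_u j 0
}.

Lemma gi_splitE (F : realFieldType) (n m : nat) (P : qp F n m)
    (istar : 'I_m) (k : nat) (S : gi_state P istar k) :
  n = (k + (n - k))%N.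
Proof. exact: esym (subnKC (full_col_rank_leq (gi_rank S))). Qed.

Definition gi_J2 (F : realFieldType) (n m : nat) (P : qp F n m)
    (istar : 'I_m) (k : nat) (S : gi_state P istar k) :
    'M[F]_(n, n - k) :=
  rsubmx (castmx (erefl n, gi_splitE S) (gi_J S)).

Definition gi_d (F : realFieldType) (n m : nat) (P : qp F n m)
    (istar : 'I_m) (k : nat) (S : gi_state P istar k) :
    'cV[F]_(k + (n - k)) :=
  castmx (gi_splitE S, erefl 1%N) ((gi_J S)^T *m qp_c P istar).

Definition gi_z (F : realFieldType) (n m : nat) (P : qp F n m)
    (istar : 'I_m) (k : nat) (S : gi_state P istar k) :
    'cV[F]_n :=
  gi_J2 S *m dsubmx (gi_d S).

Definition gi_r (F : realFieldType) (n m : nat) (P : qp F n m)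
    (istar : 'I_m) (k : nat) (S : gi_state P istar k) :
    'cV[F]_k :=
  invmx (gi_R S) *m usubmx (gi_d S).

(* Main.v *)
(* If z = 0 then n_* = A r, since d_2 = J_2^T G z vanishes and J^T is
   invertible.  For a feasible y this gives
   n_*^T (y - x) = sum_j r_j (c_j^T y - b_j) <= 0, whereas
   n_*^T y >= b_* > n_*^T x. *)
Require Import Defs.
From mathcomp Require Import all_boot all_order all_algebra.

Import Order.TTheory GRing.Theory Num.Theory.
Local Open Scope ring_scope.

Lemma dotvE (F : realFieldType) (n : nat) (v w : 'cV[F]_n) :
  dotv v w = \sum_i v i 0 * w i 0.
Proof. by rewrite /dotv mxE; apply: eq_bigr => i _; rewrite mxE. Qed.

Lemma dotv_mulmxl (F : realFieldType) (n k : nat) (A : 'M[F]_(n, k))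
    (v : 'cV[F]_k) (w : 'cV[F]_n) :
  dotv (A *m v) w = dotv v (A^T *m w).
Proof. by rewrite /dotv trmx_mul mulmxA. Qed.

Lemma dotvBr (F : realFieldType) (n : nat) (v w1 w2 : 'cV[F]_n) :
  dotv v (w1 - w2) = dotv v w1 - dotv v w2.
Proof. by rewrite /dotv mulmxBr !mxE. Qed.

Lemma normals_trmul (F : realFieldType) (n m k : nat) (P : qp F n m)
    (W : k.-tuple 'I_m) (y : 'cV[F]_n) (j : 'I_k) :
  ((normals P W)^T *m y) j 0 = dotv (qp_c P (tnth W j)) y.
Proof. by rewrite dotvE mxE; apply: eq_bigr => i _; rewrite !mxE. Qed.

(** Both sides have the same image under the invertible [J^T], namely [d]. The splitting of [n] is
    an arbitrary equation with [n] a variable, so that [n] can be substituted away and every cast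
    becomes an identity. *)
Lemma mulmx_r_of_z_eq0 (F : fieldType) (n k p : nat) (e : n = (k + p)%N)
    (e' : (k + p)%N = n) (J G : 'M[F]_n) (R : 'M[F]_k) (A : 'M[F]_(n, k))
    (c : 'cV[F]_n) :
  let d := castmx (e, erefl 1%N) (J^T *m c) in
  J^T *m G *m J = 1%:M -> R \in unitmx ->
  J^T *m A = castmx (e', erefl k) (col_mx R 0) ->
  rsubmx (castmx (erefl n, e) J) *m dsubmx d = 0 ->
  A *m (invmx R *m usubmx d) = c.
Proof.
move: e'; subst n => e' d; rewrite {}/d !castmx_id => JGJ Runit JA z0.
have JTunit : J^T \in unitmx.
  by have [] := mulmx1_unit (etrans (mulmxA _ _ _) JGJ).
have d2_0 : dsubmx (J^T *m c) = 0.
  (* Padding [d_2] with a zero upper block makes [J] send it to [J_2 d_2 = z = 0], while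
     [J^T G J = 1] returns the padded vector itself. *)
  have : J^T *m G *m J *m col_mx 0 (dsubmx (J^T *m c)) = 0.
    by rewrite -mulmxA -{2}[J]hsubmxK mul_row_col mulmx0 add0r z0 mulmx0.
  by rewrite JGJ mul1mx => /(congr1 dsubmx); rewrite col_mxKd linear0.
(* Under [J^T], the left side becomes [(R R^-1 d_1, 0) = (d_1, 0)], which is [d] because
   [d_2 = 0]. *)
apply: (can_inj (mulKmx JTunit)).
by rewrite mulmxA JA mul_col_mx mul0mx mulKVmx // -{1}d2_0 vsubmxK.
Qed.

Theorem proposition5p3 (F : realFieldType) (n m : nat) (P : qp F n m)
    (istar : 'I_m) (k : nat) (S : gi_state P istar k)
    (istar_ineq : is_ineq P istar)
    (violated : slack P (gi_x S) istar < 0)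
    (z_eq0 : gi_z S = 0)
    (r_le0 : forall j : 'I_k, is_ineq P (tnth (gi_W S) j) -> gi_r S j 0 <= 0) :
  ~ exists y : 'cV[F]_n, feasible P y.
Proof.
move=> [y y_feas].
have Ar : normals P (gi_W S) *m gi_r S = qp_c P istar.
  exact: mulmx_r_of_z_eq0 (gi_JGJ S) (gi_R_unit S) (gi_JA S) z_eq0.
have dir_gt0 : 0 < dotv (qp_c P istar) (y - gi_x S).
  rewrite dotvBr subr_gt0; move: violated; rewrite /slack subr_lt0 => /lt_le_trans.
  by apply; exact: (y_feas istar).2.
suff: dotv (qp_c P istar) (y - gi_x S) <= 0 by rewrite leNgt dir_gt0.
(* Moving [A] across the product and using [A^T x = b] on the working set turns each term into [r_j]
   times the slack of [y] at constraint [j]. *)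
rewrite -Ar dotv_mulmxl mulmxBr gi_x_active dotvE sumr_le0 // => j _.
rewrite [X in _ * X]mxE normals_trmul [X in _ + X]mxE [rhs _ _ _ _]mxE.
have [eq_j ineq_j] := y_feas (tnth (gi_W S) j).
(* At an equality the sign of [r_j] is unknown, but the slack of [y] is zero there. *)
case: (boolP (is_ineq P (tnth (gi_W S) j))) => [j_ineq | j_eq].
  by apply: mulr_le0_ge0; rewrite ?subr_ge0; [exact: r_le0 | exact: ineq_j].
by rewrite eq_j // subrr mulr0.
Qed.
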